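(* There exist an infinite Sidon set $A = \{a_1 < a_2 < \cdots\} \subset \mathbb{N}$ (i.e. $s_A = 1$) and an infinite set $B = \{b_1 < b_2 < \cdots\} \subset \mathbb{N}$ such that $d_{A,B}(n) \ll n^{1/3}$ and $s_B(n) \gg n^{1/3}$.
   Context: $\mathbb{N}$ denotes the set of nonnegative integers. A set $A$ of positive integers is a Sidon set if all the sums $a+b$ with $a,b \in A$, $a \le b$, are distinct. For infinite sets $A = \{a_1 < a_2 < \cdots\}$, $B = \{b_1 < b_2 < \cdots\}$ of nonnegative integers, enumerated increasingly: $R_A(n)$ is the number of pairs $(i,j)$ with $i \le j$ and $a_i + a_j = n$; $s_A(x) = \max_{n \le x} R_A(n)$ and $s_A = \lim_{x\to\infty} s_A(x)$ (similarly for $B$); $d_{A,B}(x) = \max\{|a_t - b_t| : a_t \le x \text{ or } b_t \le x\}$. $f \ll g$ (equivalently $g \gg f$) means $f = O(g)$ as the variable tends to infinity. *)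

(* Defs.v *)
From HB Require Import structures.
From mathcomp Require Import all_boot all_order all_algebra.
From mathcomp Require Import all_classical all_reals all_analysis.
Import Order.TTheory GRing.Theory Num.Theory.
Import numFieldNormedType.Exports.

Set Implicit Arguments.
Unset Strict Implicit.
Unset Printing Implicit Defensive.

Local Open Scope nat_scope.
Local Open Scope classical_set_scope.

(* Indices start at 0: a i is the (i+1)-st element of A. *)
Definition increasing_enum (a : nat -> nat) (A : set nat) : Prop :=
  {homo a : i j / i < j} /\ range a = A.

Definition sidon (A : set nat) : Prop :=
  (forall x, A x -> 0 < x) /\
  forall x y z t, A x -> A y -> A z -> A t ->
    x <= y -> z <= t -> x + y = z + t -> x = z /\ y = t.

(* An increasing enumeration satisfies i <= a i: this is what makes the
   finite index ranges in [R_] and [d_] below exhaustive. *)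
Lemma increasing_enum_ge a A : increasing_enum a A -> forall i, i <= a i.
Proof.
move=> [a_incr _]; elim=> // i IHi.
by apply: leq_ltn_trans IHi _; apply: a_incr.
Qed.

Definition R_ (a : nat -> nat) (n : nat) : nat :=
  #|[set ij : 'I_n.+1 * 'I_n.+1 | (ij.1 <= ij.2) && (a ij.1 + a ij.2 == n)]%SET|.

Definition s_ (a : nat -> nat) (x : nat) : nat := \max_(n < x.+1) R_ a n.

(* The maximum over an empty set of indices is 0; this only occurs for x
   smaller than both a 0 and b 0. The difference is the one of integers. *)
Definition d_ (a b : nat -> nat) (x : nat) : nat :=
  \max_(t < x.+1 | (a t <= x) || (b t <= x)) `|((a t)%:Z - (b t)%:Z)%R|%N.

(* Main.v *)
Require Import Defs.
From HB Require Import structures.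
From mathcomp Require Import all_boot all_order all_algebra.
From mathcomp Require Import all_classical all_reals all_analysis.
From mathcomp Require Import zify.
Import Order.TTheory GRing.Theory Num.Theory.
Import numFieldNormedType.Exports.

(** The set A is built from pairs [low n < high n], grouped in dyadic blocks:
    the indices n with [scale n = M], M = 2^k, form one block, all of whose
    elements lie in [[N, 4N)] where [N = base n = 256 M^3]. The sum of a pair
    is prescribed, [low n + high n = 4N + n]: pairs have distinct sums, but
    within a block these sums agree up to O(M) = O(N^(1/3)). Lowering
    [high n] by n turns them all into 4N. So B, which consists of the
    [low n] and the [mirror n = 4N - low n], represents 4N in at least M
    ways, while no element moves by more than n < 2M.

    Prescribing the sum leaves one free parameter per pair, namely [low n] in
    [[N, 2N)], and it can be chosen greedily. Every coincidence of sums that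
    involves just one of the two new elements, or both of them on different
    sides, is a linear equation in [low n] that involves at most three old
    elements. As there are 2n < 4M old elements, O(M^3) values are excluded,
    fewer than N. The one coincidence outside the reach of this choice is
    between [low n + high n] and the sum of two old elements. It is ruled out
    ([pair_sum_new]) by also keeping [low n] at distance at least 2M from its
    predecessors, which excludes O(M^2) further values. The same separation
    makes the passage from A to B increasing ([entry_shifted_compare]), so
    that it matches the two enumerations. *)

Local Open Scope classical_set_scope.
Local Open Scope nat_scope.

(** * Extending a finite set with distinct sums *)

(** The Sidon property without the ordering of the summands, so that the
    case analyses below need not sort them. *)
Definition distinct_sums (S : seq nat) : Prop :=
  forall x y z t, x \in S -> y \in S -> z \in S -> t \in S ->
    x + y = z + t -> (x = z /\ y = t) \/ (x = t /\ y = z).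

Lemma distinct_sums_cons (w : nat) (S : seq nat) :
  distinct_sums S -> w \notin S ->
  (forall x y z, x \in S -> y \in S -> z \in S -> w + x <> y + z) ->
  (forall y z, y \in S -> z \in S -> w + w <> y + z) ->
  distinct_sums (w :: S).
Proof.
move=> SS wS w1 w2 x y z t.
rewrite !inE => /predU1P[->|xS] /predU1P[->|yS] /predU1P[->|zS].
all: move=> /predU1P[->|tS] e.
all: try by [left; lia | right; lia].
- by case: (w2 _ _ zS tS).
- by case: (w1 _ _ _ yS zS tS).
- by case: (w1 _ _ _ xS zS tS); lia.
- by case: (w2 _ _ xS yS).
- by case: (w1 _ _ _ tS xS yS).
- by case: (w1 _ _ _ zS xS yS); lia.
- exact: SS.
Qed.

(** The values u for which adding u and [v = m - u] to S would create one of
    the equalities of sums [u + x = y + z], [v + x = y + z], [2u = y + z],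
    [2v = y + z], [v + x = u + y], [2u = v + x], [2v = u + x] with x, y, z in
    S, each solved for u, or would put u within g of an element of S.
    Truncated subtraction and Euclidean division may list further values: only
    their number matters. *)
Definition forbidden (S : seq nat) (m g : nat) : seq nat :=
  let D := [seq y + z | y <- S, z <- S] in
  [seq d - x | d <- D, x <- S] ++ [seq m + x - d | d <- D, x <- S] ++
  [seq d %/ 2 | d <- D] ++ [seq (2 * m - d) %/ 2 | d <- D] ++
  [seq (m + y - x) %/ 2 | y <- S, x <- S] ++
  [seq (m + x) %/ 3 | x <- S] ++ [seq (2 * m - x) %/ 3 | x <- S] ++
  [seq x + t - g | x <- S, t <- iota 0 (2 * g)].

Lemma size_forbidden S m g :
  size (forbidden S m g) =
  2 * size S ^ 3 + 3 * size S ^ 2 + 2 * size S + 2 * g * size S.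
Proof.
rewrite /forbidden !(size_cat, size_allpairs, size_map) size_iota.
by rewrite !expnS expn0; lia.
Qed.

Section Forbidden.
Variables (S : seq nat) (m g u : nat).
Hypothesis uF : u \notin forbidden S m g.

Lemma forbidden_near x : x \in S -> u + g < x \/ x + g <= u.
Proof.
move=> xS; apply/orP; apply: contraNT uF; rewrite negb_or => /andP[h1 h2].
rewrite /forbidden /= !mem_cat.
suff -> : u \in [seq x + t - g | x <- S, t <- iota 0 (2 * g)] by rewrite !orbT.
apply/allpairsP; exists (x, u + g - x); split => //=; last lia.
rewrite mem_iota; lia.
Qed.

Variable v : nat.
Hypothesis uv : u + v = m.

Lemma forbidden_u x y z :
  x \in S -> y \in S -> z \in S -> u + x <> y + z.
Proof.
move=> xS yS zS e; move: uF; rewrite /forbidden /= !mem_cat.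
suff -> : u \in [seq d - x | d <- [seq y + z | y <- S, z <- S], x <- S] by [].
apply/allpairsP; exists (y + z, x); split => //=; last lia.
by apply/allpairsP; exists (y, z).
Qed.

Lemma forbidden_v x y z :
  x \in S -> y \in S -> z \in S -> v + x <> y + z.
Proof.
move=> xS yS zS e; move: uF; rewrite /forbidden /= !mem_cat.
suff -> : u \in [seq m + x - d | d <- [seq y + z | y <- S, z <- S], x <- S].
  by rewrite !orbT.
apply/allpairsP; exists (y + z, x); split => //=; last lia.
by apply/allpairsP; exists (y, z).
Qed.

Lemma forbidden_uu y z : y \in S -> z \in S -> u + u <> y + z.
Proof.
move=> yS zS e; move: uF; rewrite /forbidden /= !mem_cat.
suff -> : u \in [seq d %/ 2 | d <- [seq y + z | y <- S, z <- S]].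
  by rewrite !orbT.
apply/mapP; exists (y + z); last lia.
by apply/allpairsP; exists (y, z).
Qed.

Lemma forbidden_vv y z : y \in S -> z \in S -> v + v <> y + z.
Proof.
move=> yS zS e; move: uF; rewrite /forbidden /= !mem_cat.
suff -> : u \in [seq (2 * m - d) %/ 2 | d <- [seq y + z | y <- S, z <- S]].
  by rewrite !orbT.
apply/mapP; exists (y + z); last lia.
by apply/allpairsP; exists (y, z).
Qed.

Lemma forbidden_uv x y : x \in S -> y \in S -> v + x <> u + y.
Proof.
move=> xS yS e; move: uF; rewrite /forbidden /= !mem_cat.
suff -> : u \in [seq (m + y - x) %/ 2 | y <- S, x <- S] by rewrite !orbT.
by apply/allpairsP; exists (x, y); split => //=; lia.
Qed.

Lemma forbidden_uuv x : x \in S -> u + u <> v + x.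
Proof.
move=> xS e; move: uF; rewrite /forbidden /= !mem_cat.
suff -> : u \in [seq (m + x) %/ 3 | x <- S] by rewrite !orbT.
by apply/mapP; exists x => //; lia.
Qed.

Lemma forbidden_vvu x : x \in S -> v + v <> u + x.
Proof.
move=> xS e; move: uF; rewrite /forbidden /= !mem_cat.
suff -> : u \in [seq (2 * m - x) %/ 3 | x <- S] by rewrite !orbT.
by apply/mapP; exists x => //; lia.
Qed.

(** The only equality that avoiding [forbidden] cannot exclude is
    [u + v = x + y] with x and y in S, because u + v is prescribed. *)
Lemma distinct_sums_pair :
  distinct_sums S -> u <> v ->
  (forall x y, x \in S -> y \in S -> m <> x + y) ->
  distinct_sums [:: v, u & S].
Proof.
move=> SS neq mS.
(* u \in S and v \in S are excluded by u + u <> u + u and v + v <> v + v. *)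
have uS : u \notin S.
  by apply/negP => uS; have := @forbidden_u u u u uS uS uS; lia.
have vS : v \notin S.
  by apply/negP => vS; have := @forbidden_v v v v vS vS vS; lia.
apply: distinct_sums_cons.
- by apply: distinct_sums_cons => //; [exact: forbidden_u|exact: forbidden_uu].
- by rewrite inE negb_or vS andbT; apply/eqP; lia.
- move=> x y z; rewrite !inE.
  move=> /predU1P[->|xS] /predU1P[->|yS] /predU1P[->|zS] e.
  + lia.
  + have zv : z = v by lia.
    by rewrite -zv zS in vS.
  + have yv : y = v by lia.
    by rewrite -yv yS in vS.
  + by apply: (mS _ _ yS zS); lia.
  + by apply: (forbidden_uuv _ xS).
  + by apply: (forbidden_uv _ _ xS zS).
  + by apply: (forbidden_uv _ _ xS yS); lia.
  + by apply: (forbidden_v _ _ _ xS yS zS).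
- move=> y z; rewrite !inE => /predU1P[->|yS] /predU1P[->|zS] e.
  + lia.
  + by apply: (forbidden_vvu _ zS).
  + by apply: (forbidden_vvu _ yS); lia.
  + by apply: (forbidden_vv _ _ yS zS).
Qed.

End Forbidden.

(** * Dyadic blocks *)

(** As [trunc_log 2 0 = 0], the index 0 joins 1 in the first block. *)
Definition scale n := 2 ^ trunc_log 2 n.

(** The factor 256 beats the number of forbidden values: with M = [scale n],
    fewer than 4M old elements and gap 2M, there are at most
    2(4M)^3 + 3(4M)^2 + 2(4M) + 4M(4M) <= 200 M^3 of them. *)
Definition base n := 256 * scale n ^ 3.

Lemma scale_gt0 n : 0 < scale n.
Proof. by rewrite expn_gt0. Qed.

Lemma scale_le n : scale n <= n.+1.
Proof.
case: n => [|n]; first by rewrite /scale trunc_log0.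
by apply: leqW; apply: trunc_logP.
Qed.

Lemma lt_scale n : n < 2 * scale n.
Proof. by rewrite -expnS; apply: trunc_log_ltn. Qed.

Lemma base_ge n : 256 * scale n <= base n.
Proof. by have := scale_gt0 n; rewrite /base !expnS expn0; nia. Qed.

Lemma scale_jump j n : j <= n ->
  scale j = scale n \/ 2 * scale j <= scale n.
Proof.
move=> jn; have := leq_trunc_log 2 jn; rewrite leq_eqVlt => /predU1P[e|l].
  by left; rewrite /scale e.
by right; rewrite -expnS leq_exp2l.
Qed.

Lemma base_jump j n : j <= n ->
  scale j = scale n /\ base j = base n \/ 8 * base j <= base n.
Proof.
move=> /scale_jump[e|l]; first by left; rewrite /base e.
right; rewrite /base mulnCA leq_mul2l /=.
by rewrite -[8]/(2 ^ 3) -expnMn leq_exp2r.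
Qed.

(** * The greedy choice of the pairs *)

Definition first_allowed (F : seq nat) (lo len : nat) : nat :=
  head 0 [seq x <- iota lo len | x \notin F].

Lemma first_allowedP F lo len : size F < len ->
  lo <= first_allowed F lo len < lo + len /\ first_allowed F lo len \notin F.
Proof.
move=> sF.
suff : first_allowed F lo len \in [seq x <- iota lo len | x \notin F].
  by rewrite mem_filter mem_iota => /andP[].
rewrite /first_allowed; case E : [seq x <- _ | _] => [|x s]; last first.
  by rewrite /= mem_head.
have : {subset iota lo len <= F}.
  move=> x xi; apply: contraT => xF.
  have : x \in [seq x <- iota lo len | x \notin F] by rewrite mem_filter xF.
  by rewrite E.
by move=> /(uniq_leq_size (iota_uniq _ _)); rewrite size_iota leqNgt sF.
Qed.

Definition pick_low (n : nat) (S : seq nat) : nat :=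
  first_allowed (forbidden S (4 * base n + n) (2 * scale n)) (base n) (base n).

Fixpoint elements (n : nat) : seq nat :=
  if n is j.+1 then
    let S := elements j in
    [:: 4 * base j + j - pick_low j S, pick_low j S & S]
  else [::].

Definition low n := pick_low n (elements n).
Definition high n := 4 * base n + n - low n.
Definition mirror n := 4 * base n - low n.

Lemma elementsS n : elements n.+1 = [:: high n, low n & elements n].
Proof. by []. Qed.

Lemma size_elements n : size (elements n) = 2 * n.
Proof. by elim: n => // n /= ->; lia. Qed.

Lemma lowP n : base n <= low n < 2 * base n /\
  low n \notin forbidden (elements n) (4 * base n + n) (2 * scale n).
Proof.
rewrite mul2n -addnn; apply: first_allowedP.
rewrite size_forbidden size_elements /base.
have := lt_scale n; have := scale_gt0 n; move: (scale n) => M M0 nM.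
have e1 : n <= 2 * M by lia.
have e3 : (2 * n) ^ 3 <= (4 * M) ^ 3 by rewrite leq_exp2r; lia.
have e2 : (2 * n) ^ 2 <= (4 * M) ^ 2 by rewrite leq_exp2r; lia.
(* Naming the powers of 2n keeps the remaining inequality polynomial in M. *)
move: e3 e2; set p := (2 * n) ^ 3; set q := (2 * n) ^ 2.
rewrite !expnMn !expnS !expn0; nia.
Qed.

Lemma low_bounds n : base n <= low n < 2 * base n.
Proof. by have [] := lowP n. Qed.

Lemma low_add_high n : low n + high n = 4 * base n + n.
Proof. by have := low_bounds n; rewrite /high; lia. Qed.

Lemma mem_elements n x :
  x \in elements n <-> exists2 j, j < n & x = low j \/ x = high j.
Proof.
elim: n => [|n IH]; first by split => // -[].
rewrite elementsS !inE; split.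
  case/or3P => [/eqP->|/eqP->|/IH[j jn e]].
  - by exists n => //; right.
  - by exists n => //; left.
  - by exists j => //; lia.
case=> j; rewrite ltnS leq_eqVlt => /predU1P[->|jn] e.
  by case: e => ->; rewrite eqxx ?orbT.
by apply/or3P/Or33/IH; exists j.
Qed.

Lemma low_separated j n : j < n ->
  low n + 2 * scale n < low j \/ low j + 2 * scale n <= low n.
Proof.
move=> jn; have [_ F] := lowP n.
by apply: (forbidden_near _ _ _ _ F); apply/mem_elements; exists j => //; left.
Qed.

(** If x and y are not both from the block of n, then x + y is below 4N. In
    that block, two low elements add up to less than 4N and two high ones to
    more than 4N + n; a low and a high one of different pairs add up to a
    number at distance at least 2M from some 4N + l, by separation, whereas
    |l - n| < 2M; and the sum of an older pair is 4N + j with j <> n. *)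
Lemma pair_sum_new n x y : x \in elements n -> y \in elements n ->
  4 * base n + n <> x + y.
Proof.
move=> /mem_elements[i li xi] /mem_elements[j lj yj].
have := low_bounds i; have := low_bounds j; have := low_add_high i.
have := low_add_high j.
have := lt_scale i; have := lt_scale j; have := lt_scale n.
have := scale_le i; have := scale_le j.
have := base_ge i; have := base_ge j; have := base_ge n.
have := base_jump _ _ (ltnW li); have := base_jump _ _ (ltnW lj).
have sij : i <> j -> scale i = scale n -> scale j = scale n ->
   low i + 2 * scale n <= low j \/ low j + 2 * scale n <= low i.
  move=> ij si sj; have [l|l|] := ltngtP i j; last by [].
    by have := low_separated _ _ l; lia.
  by have := low_separated _ _ l; lia.
have [ij|/eqP/sij {}sij] := eqVneq i j.
  by subst j; case: xi; case: yj; lia.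
by case: xi; case: yj; lia.
Qed.

Lemma distinct_sums_elements n : distinct_sums (elements n).
Proof.
elim: n => [|n IH]; first by move=> x.
rewrite elementsS; have [_ F] := lowP n.
apply: (distinct_sums_pair _ _ _ _ F _ (low_add_high n)) => //.
  by have := low_bounds n; have := low_add_high n; lia.
exact: pair_sum_new.
Qed.

(** * Matching the two sets *)

(** Indexing A by pairs (n, c), where c tells the high element from the low
    one, lets [shifted] be defined without inverting the enumeration of A. *)
Definition entry (p : nat * bool) := if p.2 then high p.1 else low p.1.
Definition shifted (p : nat * bool) := if p.2 then mirror p.1 else low p.1.

(** Blocks do not overlap, and within a block low elements stay below high
    ones. Two high elements of a block keep their order because the low ones
    are at least 2M apart, whereas the shifts differ by less than 2M. *)
Lemma entry_shifted_compare p q : p != q ->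
  entry p < entry q /\ shifted p < shifted q \/
  entry q < entry p /\ shifted q < shifted p.
Proof.
wlog : p q / p.1 <= q.1.
  move=> H; have [/H//|/ltnW/H{}H pq] := leqP p.1 q.1.
  by rewrite eq_sym in pq; case: (H pq); [right|left].
case: p q => [n b] [j c] /= nj.
rewrite xpair_eqE negb_and /entry /shifted /=.
have := low_bounds n; have := low_bounds j; have := low_add_high n.
have := low_add_high j; rewrite /mirror.
have := lt_scale n; have := lt_scale j; have := scale_gt0 j.
have := base_ge n; have := base_ge j.
have [->|nj' _] := eqVneq n j; first by case: b; case: c => //=; lia.
have := base_jump _ _ nj; have nj2 : n < j by lia.
by have := low_separated _ _ nj2; case: b; case: c => /=; lia.
Qed.

Lemma entry_lt_shifted p q : entry p < entry q -> shifted p < shifted q.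
Proof.
have [->|/entry_shifted_compare] := eqVneq p q; first by rewrite ltnn.
lia.
Qed.

Lemma entry_inj : injective entry.
Proof.
move=> p q e; apply/eqP; apply: contraT => /entry_shifted_compare; lia.
Qed.

(** The shift is at most p.1 < 2M, and (2M)^3 = 8 M^3 is below 256 M^3, the
    lower end of the block. *)
Lemma shifted_near p :
  shifted p <= entry p /\ (entry p - shifted p) ^ 3 <= shifted p.
Proof.
have [bl bh] : base p.1 <= shifted p /\ shifted p <= entry p <= shifted p + p.1.
  have := low_bounds p.1; have := low_add_high p.1.
  by rewrite /entry /shifted /mirror; case: ifP => _; lia.
split; first lia.
apply: leq_trans bl; rewrite /base.
apply: (@leq_trans ((2 * scale p.1) ^ 3)).
  by rewrite leq_exp2r; have := lt_scale p.1; lia.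
by rewrite expnMn leq_mul2r orbT.
Qed.

Lemma entry_elements p n : p.1 < n -> entry p \in elements n.
Proof.
move=> pn; apply/mem_elements; exists p.1 => //.
by rewrite /entry; case: p.2; auto.
Qed.

Lemma sidon_range_entry : sidon (range entry).
Proof.
split=> [_ [p _ <-]|_ _ _ _ [p _ <-] [q _ <-] [r _ <-] [s _ <-] pq rs e].
  have := base_ge p.1; have := scale_gt0 p.1.
  have := low_bounds p.1; have := low_add_high p.1.
  by rewrite /entry; case: ifP => _; lia.
(* Four elements all lie in some finite stage of the construction. *)
pose n := (p.1 + q.1 + r.1 + s.1).+1.
have inS x : x.1 < n -> entry x \in elements n by exact: entry_elements.
have := distinct_sums_elements n _ _ _ _
  (inS p _) (inS q _) (inS r _) (inS s _) e.
by rewrite /n; lia.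
Qed.

(** * Enumerations and representation counts *)

Lemma unbounded_enum (A : set nat) :
  (forall n, exists2 x, A x & n <= x) -> exists a, increasing_enum a A.
Proof.
move=> unb.
have /choice[next nextP] n : exists x,
    [/\ A x, n <= x & forall y, A y -> n <= y -> x <= y].
  have ex : exists x, `[< A x /\ n <= x >].
    by have [x Ax nx] := unb n; exists x; apply/asboolP.
  have [x /asboolP[Ax nx] xmin] := ex_minnP ex.
  by exists x; split => // y Ay ny; apply: xmin; apply/asboolP.
pose a := fix a i := if i is j.+1 then next (a j).+1 else next 0.
have aS i : a i < a i.+1 by have [] := nextP (a i).+1.
have a_incr : {homo a : i j / i < j} by apply: homo_ltn => //; exact: ltn_trans.
have a_ge i : i <= a i.
  by elim: i => // i IH; apply: leq_ltn_trans IH (aS i).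
exists a; split => //; apply/seteqP; split => [_ [i _ <-]|x Ax].
  by case: i => [|i]; [have [] := nextP 0|have [] := nextP (a i).+1].
have ex : exists i, x <= a i by exists x.
have [i xi imin] := ex_minnP ex; exists i => //.
apply/eqP; rewrite eqn_leq xi andbT.
case: i xi imin => [|i] xi imin /=.
  by have [_ _] := nextP 0; apply.
have [_ _] := nextP (a i).+1; apply=> //.
by rewrite ltnNge; apply/negP => /imin; rewrite ltnn.
Qed.

Lemma leq_R_s a m x : m <= x -> R_ a m <= s_ a x.
Proof.
by rewrite -ltnS => mx; rewrite /s_ (bigD1 (Ordinal mx)) //= leq_maxl.
Qed.

Lemma s_sidon (A : set nat) a :
  increasing_enum a A -> sidon A -> forall x, a 0 + a 0 <= x -> s_ a x = 1.
Proof.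
move=> aA [A0 AS] x x0.
have [a_incr aE] := aA.
have inA i : A (a i) by rewrite -aE; exists i.
have a_mono : {mono a : i j / i <= j} := leq_mono a_incr.
have a_inj : injective a by apply: incn_inj.
apply/eqP; rewrite eqn_leq; apply/andP; split.
  apply/bigmax_leqP => n _; apply/card_le1_eqP => -[i j] [i' j'].
  rewrite !inE /= => /andP[ij /eqP e] /andP[i'j' /eqP e'].
  have [] := AS (a i) (a j) (a i') (a j') (inA _) (inA _) (inA _) (inA _).
  - by rewrite a_mono.
  - by rewrite a_mono.
  - by rewrite e e'.
  by move=> /a_inj/val_inj-> /a_inj/val_inj->.
apply: leq_trans (leq_R_s _ _ _ x0).
by apply/card_gt0P; exists (ord0, ord0); rewrite inE /= eqxx.
Qed.

Section ShiftedEnumeration.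
Variables (a : nat -> nat) (p : nat -> nat * bool).
Hypothesis aA : increasing_enum a (range entry).
Hypothesis ap : forall t, a t = entry (p t).
Let b t := shifted (p t).

Lemma shifted_enum : increasing_enum b (range b).
Proof.
split=> // i j ij; apply: entry_lt_shifted.
by rewrite -!ap; apply: (proj1 aA).
Qed.

Lemma d_shifted x : d_ a b x ^ 3 <= x.
Proof.
rewrite /d_; elim/big_ind: _ => [//|m n|t].
  by rewrite /maxn; case: ifP.
rewrite ap /b => tx; have [le1 le3] := shifted_near (p t).
have -> : `|((entry (p t))%:Z - (shifted (p t))%:Z)%R|%N
    = entry (p t) - shifted (p t) by lia.
by apply: leq_trans le3 _; case/orP: tx; lia.
Qed.

Lemma index_of q : exists t, p t = q.
Proof.
have : range entry (entry q) by exists q.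
by rewrite -(proj2 aA) => -[t _]; rewrite ap => /entry_inj; exists t.
Qed.

Lemma scale_block k i : i < 2 ^ k -> scale (2 ^ k + i) = 2 ^ k.
Proof.
move=> ik; rewrite /scale (@trunc_log_eq 2 k) //.
by rewrite leq_addr /= expnS mul2n -addnn ltn_add2l.
Qed.

(** The 2^k indices 2^k + i with i < 2^k have scale 2^k, and each of them
    yields the representation [low + mirror] of 4 * base = 1024 * 8^k. *)
Lemma R_shifted k : 2 ^ k <= R_ b (1024 * 8 ^ k).
Proof.
set T := 1024 * 8 ^ k.
have [idx idxP] := choice index_of.
have idx_le q : idx q <= shifted q.
  by rewrite -{2}(idxP q); apply: (increasing_enum_ge shifted_enum).
have baseT i : i < 2 ^ k -> 4 * base (2 ^ k + i) = T.
  move=> ik; rewrite /base scale_block // /T -expnM (mulnC k) expnM.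
  by rewrite mulnA.
pose f (i : 'I_(2 ^ k)) : 'I_T.+1 * 'I_T.+1 :=
  (inord (idx (2 ^ k + i, false)), inord (idx (2 ^ k + i, true))).
have idx_le_sum (i : 'I_(2 ^ k)) c : idx (2 ^ k + i, c) < T.+1.
  rewrite ltnS; apply: leq_trans (idx_le _) _.
  have := baseT i (ltn_ord i); have := low_bounds (2 ^ k + i).
  by rewrite /shifted /mirror; case: c => /=; lia.
have f_inj : injective f.
  move=> i j [] /(congr1 val) /=; rewrite !inordK // => /(congr1 p).
  by rewrite !idxP => -[] /addnI/val_inj.
rewrite -[2 ^ k]card_ord -(card_imset _ f_inj).
apply/subset_leq_card/fintype.subsetP => _ /imsetP[i _ ->].
rewrite inE /= !inordK // /b !idxP.
have := baseT i (ltn_ord i); have := low_bounds (2 ^ k + i).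
have := base_ge (2 ^ k + i); have := lt_scale (2 ^ k + i).
have := low_add_high (2 ^ k + i).
set n := 2 ^ k + i => h1 h2 h3 h4 h5.
apply/andP; split; last by rewrite /shifted /mirror /=; lia.
have : a (idx (n, false)) < a (idx (n, true)).
  by rewrite !ap !idxP /entry /=; lia.
move=> a_lt; rewrite leqNgt; apply/negP => /(proj1 aA); lia.
Qed.

(** If k is largest with 1024 * 8^k <= n, then n < 8192 * (2^k)^3, and
    8192 <= 21^3 = 9261. *)
Lemma s_shifted n : 1024 <= n -> n <= (21 * s_ b n) ^ 3.
Proof.
move=> n1; have n0 : 0 < n %/ 1024 by lia.
have /andP[lo hi] := trunc_log_bounds (isT : 1 < 8) n0.
move: lo hi; set k := trunc_log 8 _; rewrite expnS => lo hi.
have := R_shifted k; have : 1024 * 8 ^ k <= n by lia.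
move=> /leq_R_s/(leq_trans _) h /h {}h.
apply: (@leq_trans ((21 * 2 ^ k) ^ 3)); last by rewrite leq_exp2r // leq_mul2l.
by rewrite expnMn -expnM (mulnC k) expnM -[2 ^ 3]/8; lia.
Qed.

End ShiftedEnumeration.

(** * Cube roots and the theorem *)

Local Open Scope ring_scope.

Lemma cubeK (R : realType) (m : nat) :
  ((m ^ 3)%N)%:R `^ 3^-1 = m%:R :> R.
Proof. by rewrite natrX -powR_mulrn // -powRrM mulfV // powRr1. Qed.

Lemma cube_le_powR (R : realType) (m n : nat) :
  (m ^ 3 <= n)%N -> m%:R <= n%:R `^ 3^-1 :> R.
Proof.
move=> mn; rewrite -cubeK.
by apply: ge0_ler_powR; rewrite ?nnegrE ?invr_ge0 // ler_nat.
Qed.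

Lemma powR_le_cube (R : realType) (m n : nat) :
  (n <= m ^ 3)%N -> n%:R `^ 3^-1 <= m%:R :> R.
Proof.
move=> mn; rewrite -(cubeK R m).
by apply: ge0_ler_powR; rewrite ?nnegrE ?invr_ge0 // ler_nat.
Qed.

Theorem theorem6 (R : realType) :
  exists (A B : set nat) (a b : nat -> nat),
    [/\ increasing_enum a A,
        increasing_enum b B,
        sidon A /\ s_ a x @[x --> \oo] --> 1%N,
        (fun n : nat => (d_ a b n)%:R : R^o) =O_\oo
          (fun n : nat => n%:R `^ 3^-1 : R^o)
      & (fun n : nat => n%:R `^ 3^-1 : R^o) =O_\oo
          (fun n : nat => (s_ b n)%:R : R^o)].
Proof.
have [|a aA] := @unbounded_enum (range entry).
  move=> n; exists (low n); first by exists (n, false).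
  have := low_bounds n; have := base_ge n; have := lt_scale n; lia.
have /choice[p ap] t : exists q, a t = entry q.
  have : range entry (a t) by rewrite -(proj2 aA); exists t.
  by case=> q _ <-; exists q.
pose b t := shifted (p t).
exists (range entry), (range b), a, b; split.
- exact: aA.
- exact: shifted_enum aA ap.
- split; first exact: sidon_range_entry.
  apply: cvg_near_cst; exists (a 0%N + a 0%N)%N => //= x.
  exact: s_sidon aA sidon_range_entry x.
- apply/eqOP; near=> k; near=> n.
  rewrite !ger0_norm ?powR_ge0 //.
  apply: (@le_trans _ _ (1 * n%:R `^ 3^-1)).
    by rewrite mul1r; apply/cube_le_powR/d_shifted.
  by rewrite ler_wpM2r ?powR_ge0.
- apply/eqOP; near=> k; near=> n.
  rewrite !ger0_norm ?powR_ge0 //.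
  apply: (@le_trans _ _ (21 * (s_ b n)%:R)).
    rewrite -natrM; apply: powR_le_cube; apply: s_shifted aA ap _ _.
    by near: n; exists 1024%N.
  by rewrite ler_wpM2r.
Unshelve. all: by end_near. Qed.
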